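(* For any fixed $\delta$, there is no deterministic LOCAL algorithm with running time $o(n)$ that computes a hypergraph sinkless orientation on all $n$-node hypergraphs with minimum degree $\delta$ and maximum rank $r=\delta$.
   Context: A hypergraph sinkless orientation (HSO) of a (multi)hypergraph orients each hyperedge so that it is outgoing for exactly one of its vertices and incoming for all others, such that every vertex has at least one outgoing hyperedge. The degree of a vertex is the number of hyperedges containing it; the rank of a hyperedge is its number of vertices. LOCAL on a hypergraph $G$ means the LOCAL model run on its bipartite representation $\mathcal{B}_G$ (vertices of $G$ on one side, hyperedges on the other, vertex $v$ adjacent to hyperedge $e$ iff $v\in e$): nodes have unique IDs, communicate in synchronous rounds with unbounded local computation and unbounded message size, and the running time is the number of rounds until all outputs are fixed.
   Formalization: The formal theorem assumes δ ≥ 2: for δ = 1 every hyperedge is a single vertex and orienting it toward that vertex is a constant-time algorithm, so the claim fails, and for δ = 0 the class is degenerate. *)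

(* Defs.v *)
From mathcomp Require Import all_boot all_order all_algebra.

Set Implicit Arguments.
Unset Strict Implicit.
Unset Printing Implicit Defensive.

(* Hyperedges are labelled, so that parallel hyperedges are possible; a
   hypergraph without parallel hyperedges is one satisfying [simple_hypergraph].
   A hyperedge without vertices could not be oriented at all. *)
Record hypergraph := Hypergraph {
  vert : finType;
  hedge : finType;
  vset : hedge -> {set vert};
  vset_neq0 : forall e, vset e != set0
}.

Definition simple_hypergraph (G : hypergraph) : Prop := injective (@vset G).

Definition vdegree (G : hypergraph) (v : vert G) : nat :=
  #|[set e : hedge G | v \in vset e]|.

Definition rank (G : hypergraph) (e : hedge G) : nat := #|vset e|.

Definition min_degree (G : hypergraph) (d : nat) : Prop :=
  (forall v : vert G, d <= vdegree v) /\ (exists v : vert G, vdegree v = d).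

Definition max_rank (G : hypergraph) (r : nat) : Prop :=
  (forall e : hedge G, rank e <= r) /\ (exists e : hedge G, rank e = r).

(* [outgoing e v] reads: e is outgoing for v.  It is only relevant for v in e;
   a hyperedge is incoming for those of its vertices it is not outgoing for. *)
Definition is_HSO (G : hypergraph) (outgoing : hedge G -> vert G -> bool) :
    Prop :=
  (forall e, exists! v, v \in vset e /\ outgoing e v) /\
  (forall v, exists e, v \in vset e /\ outgoing e v).

(* The bipartite representation of G. *)
Definition bnode (G : hypergraph) : finType := (vert G + hedge G)%type.

Definition badj (G : hypergraph) (x y : bnode G) : bool :=
  match x, y with
  | inl v, inr e => v \in vset e
  | inr e, inl v => v \in vset e
  | _, _ => false
  end.

(* IDs are polynomially bounded in the number of nodes of the network. *)
Definition valid_ids (c : nat) (G : hypergraph) (id : bnode G -> nat) : Prop :=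
  injective id /\ (forall x, 1 <= id x <= #|bnode G| ^ c).

Record local_input := LocalInput {
  num_vert : nat;
  num_hedge : nat;
  is_hedge : bool;
  own_id : nat;
  num_nbrs : nat
}.

(* In each round a node sends a message to each of its neighbours, addressed by
   their IDs, and then updates its state with the messages it received, which
   are indexed by the IDs of the senders ([None] if no neighbour has that ID).
   Each hyperedge orients itself: its output is the ID of the vertex for which
   it is outgoing.  The outputs of the vertex nodes are ignored. *)
Record local_algorithm := LocalAlgorithm {
  state : Type;
  message : Type;
  init : local_input -> state;
  send : state -> nat -> message;
  receive : state -> (nat -> option message) -> state;
  output : state -> nat
}.

Section Execution.
Variables (A : local_algorithm) (G : hypergraph) (id : bnode G -> nat).

Definition input_at (x : bnode G) : local_input :=
  {| num_vert := #|vert G|;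
     num_hedge := #|hedge G|;
     is_hedge := if x is inr _ then true else false;
     own_id := id x;
     num_nbrs := #|[set y | badj x y]| |}.

Definition inbox (s : bnode G -> state A) (x : bnode G) (i : nat) :
    option (message A) :=
  if [pick y | badj x y && (id y == i)] is Some y
  then Some (send (s y) (id x)) else None.

Fixpoint state_at (t : nat) : bnode G -> state A :=
  if t is t'.+1
  then fun x => receive (state_at t' x) (inbox (state_at t') x)
  else fun x => init A (input_at x).

Definition output_at (t : nat) (e : hedge G) : nat :=
  output (state_at t (inr e)).

Definition outputs_fixed_after (t : nat) : Prop :=
  forall t', t <= t' -> forall e, output_at t' e = output_at t e.

Definition outgoing_at (t : nat) (e : hedge G) (v : vert G) : bool :=
  output_at t e == id (inl v).

End Execution.

(* A solves HSO on every hypergraph G of the class C, under every assignment of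
   IDs, within T n rounds, where n is the number of vertices of G. *)
Definition computes_HSO (A : local_algorithm) (T : nat -> nat) (c : nat)
    (C : hypergraph -> Prop) : Prop :=
  forall (G : hypergraph) (id : bnode G -> nat),
    C G -> valid_ids c id ->
    outputs_fixed_after A id (T #|vert G|) /\
    is_HSO (outgoing_at A id (T #|vert G|)).

Definition is_little_o_n (T : nat -> nat) : Prop :=
  forall eps : rat, (0 < eps)%R ->
    exists n0, forall n, n0 <= n -> ((T n)%:R <= eps * n%:R)%R.

(* Main.v *)
(** When all degrees and all ranks equal [delta], an HSO is a perfect matching of
    the bipartite representation.  Take two source vertices and two sink
    hyperedges, the source and the sink of each copy being joined by [delta] long
    chains of blocks that have as many vertices as hyperedges, with a single
    incidence between consecutive blocks.  By counting, along a chain either all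
    of these connecting incidences are matched or none is, and in each copy
    exactly one chain is matched.  Now exchange the IDs of the matched chain of
    one copy with those of an unmatched chain of the other copy.  The views of the
    nodes in the middle of the chains do not reach the ends, so these nodes carry
    their decisions along, and one copy is left without a matched chain. *)

Require Import Defs.
From mathcomp Require Import all_boot all_order all_algebra all_fingroup.
From Stdlib Require Import FunctionalExtensionality.
From mathcomp Require Import zify.

Set Implicit Arguments.
Unset Strict Implicit.
Unset Printing Implicit Defensive.

(** Each hyperedge chooses its unique outgoing vertex. Every vertex is chosen, so [out] is onto, and
    equal cardinalities make it bijective. *)
Lemma is_HSO_matching (G : hypergraph) (o : hedge G -> vert G -> bool) :
  is_HSO o -> #|vert G| = #|hedge G| ->
  exists out : hedge G -> vert G,
    [/\ bijective out, forall e, out e \in vset e &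
        forall e v, v \in vset e -> o e v = (out e == v)].
Proof.
move=> [Ho Hv] cardVE.
have ex1 e : exists v, (v \in vset e) && o e v.
  by have [v [[ve oev] _]] := Ho e; exists v; rewrite ve.
pose out e := xchoose (ex1 e).
have outP e : (out e \in vset e) && o e (out e) := xchooseP (ex1 e).
have oE e v : v \in vset e -> o e v = (out e == v).
  move=> ve; have [w [_ uw]] := Ho e; have /andP[oe1 oe2] := outP e.
  apply/idP/eqP => [oev|<- //].
  by rewrite -(uw _ (conj oe1 oe2)) -(uw _ (conj ve oev)).
exists out; split=> // [|e]; last by case/andP: (outP e).
apply/inj_card_bij; last by rewrite cardVE.
suff out_inj : {in predT &, injective out} by move=> e e' /out_inj; apply.
apply/image_injP; apply/eqP; rewrite -[RHS]cardVE.
apply: eq_card => v; rewrite inE.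
have [e [ve oev]] := Hv v; apply/codomP; exists e.
by apply/esym/eqP; rewrite -oE.
Qed.

(** * The hypergraph of chains: degrees, ranks and simplicity *)

Section Construction.

Variables delta L : nat.

(** The Boolean names the copy, the ordinal one of its [delta] chains. *)
Definition link : finType := (bool * 'I_delta)%type.

(** One type serves for both vertices and hyperedges, which are thus equally many by conversion. *)
Definition site : finType := (bool + link * 'I_L.+1 * 'I_delta.+1)%type.

(* [inl k] is the source vertex, resp. the sink hyperedge, of copy [k], and
   [inr (l, i, a)] is the [a]-th vertex, resp. hyperedge, of block [i] of chain
   [l].  A block is the complete bipartite graph minus a perfect matching, in
   which the incidence of vertex [ord0] with hyperedge [ord_max] is replaced by
   incidences with the following and the preceding block. *)
Definition incident (v e : site) : bool :=
  match v, e with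
  | inl _, inl _ => false
  | inl k, inr (l, i, b) => [&& l.1 == k, i == ord0 & b == ord_max]
  | inr (l, i, a), inl k => [&& l.1 == k, i == ord_max & a == ord0]
  | inr (l, i, a), inr (l', i', b) =>
      (l == l') && (if (a == ord0) && (b == ord_max) then i.+1 == i' :> nat
                    else (i == i') && (a != b))
  end.

Hypothesis delta_gt1 : 1 < delta.

Let max_neq0 : (ord_max == ord0 :> 'I_delta.+1) = false.
Proof. by rewrite -val_eqE /=; lia. Qed.

Lemma card_incident_edges v : #|[set e | incident v e]| = delta.
Proof.
case: v => [k|[[l i] a]].
  rewrite -[RHS]card_ord.
  pose f (j : 'I_delta) : site := inr (k, j, ord0, ord_max).
  have f_inj : injective f by move=> j j' [].
  rewrite -cardsT -(card_imset _ f_inj); apply: eq_card => e; rewrite inE.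
  apply/idP/imsetP => [|[j _ ->]]; last by rewrite /= !eqxx.
  case: e => [//|[[[k' j] i] b]] /= /and3P[/eqP-> /eqP-> /eqP->].
  by exists j.
(* [f b] is the hyperedge that vertex [a] meets at index [b], once the pair [ord0], [ord_max] is
   redirected to the next block or the sink. The index [b = a] belongs to the removed matching. *)
pose f (b : 'I_delta.+1) : site :=
  if (a == ord0) && (b == ord_max)
  then if i == ord_max then inl l.1 else inr (l, inord i.+1, ord_max)
  else inr (l, i, b).
have iS : i != ord_max -> (inord i.+1 : 'I_L.+1) = i.+1 :> nat.
  by rewrite -val_eqE /= => Hi; rewrite inordK //; have := ltn_ord i; lia.
have f_inj : {in [set~ a] &, injective f}.
  move=> b b' _ _; rewrite /f.
  case: (eqVneq a ord0) => [_|_] /=; last by case.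
  case: (eqVneq b) => [->|_]; case: (eqVneq b') => [->|_] //.
  - by case: ifP => // _ [_ <-].
  - by case: ifP => // _ [_ ->].
  - by case.
rewrite -[RHS]/(delta.+1.-1) -[in RHS](card_ord delta.+1) -(cardsC1 a).
rewrite -(card_in_imset f_inj); apply: eq_card => e; rewrite inE.
apply/idP/imsetP => [|[b]]; last first.
  rewrite !inE /f => ba ->; case: ifP => [/andP[/eqP-> _]|nab].
    case: ifP => [/eqP->|/negbT/iS iE] /=; first by rewrite !eqxx.
    by rewrite !eqxx /= iE.
  by rewrite /= nab !eqxx eq_sym.
case: e => [k|[[l' i'] b]] /=.
  case/and3P=> /eqP<- /eqP im /eqP a0; exists ord_max.
    by rewrite !inE a0 max_neq0.
  by rewrite /f a0 im !eqxx.
case/andP=> /eqP<-; case: ifP => [/andP[/eqP a0 /eqP bm]|nab].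
  move/eqP=> Si; exists ord_max; first by rewrite !inE a0 max_neq0.
  rewrite /f a0 !eqxx /= ifN ?bm; last first.
    by rewrite -val_eqE /=; have := ltn_ord i'; lia.
  by congr (inr (_, _, _)); apply: val_inj; rewrite /= inordK ?Si.
case/andP=> /eqP<- ab; exists b; first by rewrite !inE eq_sym.
by rewrite /f nab.
Qed.

Lemma card_incident_vertices e : #|[set v | incident v e]| = delta.
Proof.
case: e => [k|[[l i] b]].
  rewrite -[RHS]card_ord.
  pose f (j : 'I_delta) : site := inr (k, j, ord_max, ord0).
  have f_inj : injective f by move=> j j' [].
  rewrite -cardsT -(card_imset _ f_inj); apply: eq_card => e; rewrite inE.
  apply/idP/imsetP => [|[j _ ->]]; last by rewrite /= !eqxx.
  case: e => [//|[[[k' j] i] b]] /= /and3P[/eqP-> /eqP-> /eqP->].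
  by exists j.
pose f (a : 'I_delta.+1) : site :=
  if (a == ord0) && (b == ord_max)
  then if i == ord0 then inl l.1 else inr (l, inord i.-1, ord0)
  else inr (l, i, a).
have iP : (inord i.-1 : 'I_L.+1) = i.-1 :> nat.
  by rewrite inordK //; have := ltn_ord i; lia.
have f_inj : {in [set~ b] &, injective f}.
  move=> a a' _ _; rewrite /f.
  case: (eqVneq b ord_max) => [_|_]; rewrite ?andbT ?andbF; last by case.
  case: (eqVneq a) => [->|_]; case: (eqVneq a') => [->|_] //.
  - by case: ifP => // _ [_ <-].
  - by case: ifP => // _ [_ ->].
  - by case.
rewrite -[RHS]/(delta.+1.-1) -[in RHS](card_ord delta.+1) -(cardsC1 b).
rewrite -(card_in_imset f_inj); apply: eq_card => v; rewrite inE.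
apply/idP/imsetP => [|[a]]; last first.
  rewrite !inE /f => ab ->; case: ifP => [/andP[_ /eqP->]|nab].
    case: ifP => [/eqP->|/negbT] /=; first by rewrite !eqxx.
    by rewrite !eqxx /= iP -val_eqE /=; lia.
  by rewrite /= nab !eqxx.
case: v => [k|[[l' i'] a]] /=.
  case/and3P=> /eqP<- /eqP i0 /eqP bm; exists ord0.
    by rewrite !inE bm eq_sym max_neq0.
  by rewrite /f bm i0 !eqxx.
case/andP=> /eqP->; case: ifP => [/andP[/eqP a0 /eqP bm]|nab].
  move/eqP=> Si; exists ord0; first by rewrite !inE bm eq_sym max_neq0.
  rewrite /f bm !eqxx /= ifN ?a0; last by rewrite -val_eqE /=; lia.
  by congr (inr (_, _, _)); apply: val_inj; rewrite /= iP -Si.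
case/andP=> /eqP-> ab; exists a; first by rewrite !inE.
by rewrite /f nab.
Qed.

Fact incident_neq0 e : [set v | incident v e] != set0.
Proof. by rewrite -card_gt0 card_incident_vertices; lia. Qed.

Definition chain_hypergraph : hypergraph := Hypergraph incident_neq0.

Lemma chain_min_degree : min_degree chain_hypergraph delta.
Proof.
have deg (v : vert chain_hypergraph) : vdegree v = delta.
  rewrite /vdegree -[RHS](card_incident_edges v).
  by apply: eq_card => e; rewrite !inE.
by split=> [v|]; [rewrite deg | exists (inl true); rewrite deg].
Qed.

Lemma chain_max_rank : max_rank chain_hypergraph delta.
Proof.
have rk (e : hedge chain_hypergraph) : rank e = delta.
  exact: card_incident_vertices.
by split=> [e|]; [rewrite rk | exists (inl true); rewrite rk].
Qed.

(** A vertex other than [ord0] meets only hyperedges of its own block, all but the one with its own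
    index. As [1 < delta], every block hyperedge contains such vertices, and they determine its
    block and index. The two sinks are told apart by the copy of their chains. *)
Lemma chain_simple : simple_hypergraph chain_hypergraph.
Proof.
have inner l i b e' : [set v | incident v (inr (l, i, b))] =
    [set v | incident v e'] -> exists2 b', e' = inr (l, i, b') &
    forall a, a != ord0 -> (a != b) = (a != b').
  move=> /setP eqs.
  have [a [a0 ab]] : exists a : 'I_delta.+1, a != ord0 /\ a != b.
    have : 0 < #|[set~ ord0] :\ b|.
      have := cardsD1 b [set~ (ord0 : 'I_delta.+1)].
      by rewrite cardsC1 card_ord /=; case: (b \in _); lia.
    by case/card_gt0P=> a; rewrite !inE => /andP[ab a0]; exists a.
  have := eqs (inr (l, i, a)); rewrite !inE /= (negPf a0) !eqxx /= ab.
  case: e' eqs => [k|[[l' i'] b']] eqs /=; first by rewrite !andbF.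
  move/esym/and3P=> [/eqP El /eqP Ei _]; exists b'; rewrite ?El ?Ei // => a' a'0.
  have := eqs (inr (l, i, a')); rewrite !inE /= (negPf a'0) /= !eqxx /=.
  by rewrite El Ei !eqxx.
move=> [k|[[l i] b]] e' /= eqs; last first.
  have [b' -> Hb'] := inner _ _ _ _ eqs; congr (inr (_, _, _)).
  apply/eqP/negPn/negP => bb'.
  have [b0|/Hb'] := eqVneq b ord0; last by rewrite eqxx bb'.
  have /Hb' : b' != ord0 by rewrite -b0 eq_sym.
  by rewrite eqxx eq_sym bb'.
case: e' eqs => [k'|[[l i] b]] eqs; last first.
  by have [b'] := inner _ _ _ _ (esym eqs).
have delta_gt0 : 0 < delta by lia.
move/setP/(_ (inr ((k, Ordinal delta_gt0), ord_max, ord0))): eqs.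
by rewrite !inE /= !eqxx /= andbT => /esym/eqP ->.
Qed.

(** * Perfect matchings along a chain *)

Section Matching.

Variable out : site -> site.
Hypothesis out_bij : bijective out.
Hypothesis out_incident : forall e, incident (out e) e.

Definition in_block (l : link) (i : 'I_L.+1) (x : site) : bool :=
  if x is inr (l', i', _) then (l' == l) && (i' == i) else false.

(** Hyperedge [ord_max] has a single incidence outside its block, with the preceding block or, for
    block [ord0], with the source; this tells whether that incidence is matched. *)
Definition leaves (l : link) (i : 'I_L.+1) : bool :=
  ~~ in_block l i (out (inr (l, i, ord_max))).

Lemma leaves0 l : leaves l ord0 = (out (inr (l, ord0, ord_max)) == inl l.1).
Proof.
rewrite /leaves; have := out_incident (inr (l, ord0, ord_max)).
case: (out _) => [k|[[l' i'] a]] /=; first by case/andP=> /eqP-> _; rewrite eqxx.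
case/andP=> /eqP->; rewrite !eqxx andbT /=.
case: (a == ord0) => //= /andP[-> _].
by apply/esym/negbTE/eqP.
Qed.

Lemma leavesS l (i i' : 'I_L.+1) : i' = i.+1 :> nat ->
  leaves l i' = (out (inr (l, i', ord_max)) == inr (l, i, ord0)).
Proof.
move=> Ei; rewrite /leaves; have := out_incident (inr (l, i', ord_max)).
case: (out _) => [k|[[l' j] a]] /=.
  by case/and3P=> _; rewrite -val_eqE /= Ei.
case/andP=> /eqP->; rewrite !eqxx andbT /=.
case: (eqVneq a ord0) => [->|a0] /=; last first.
  by case/andP=> -> _; apply/esym/negP => /eqP[_ aE]; rewrite aE in a0.
rewrite Ei eqSS => /eqP ji.
have -> : j = i by apply: val_inj.
by rewrite eqxx -val_eqE /= Ei; lia.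
Qed.

(* A block has as many hyperedges as vertices: if one of its hyperedges is
   matched to the preceding block, then one of its vertices is matched to the
   following block, and conversely. *)
Lemma leaves_step l (i i' : 'I_L.+1) : i' = i.+1 :> nat ->
  leaves l i' = leaves l i.
Proof.
move=> Ei; rewrite (leavesS _ Ei); have [inv outK invK] := out_bij.
pose idx (x : site) : 'I_delta.+1 := if x is inr (_, _, a) then a else ord0.
have blockE x : in_block l i x -> x = inr (l, i, idx x).
  by case: x => [//|[[l' j] a]] /= /andP[/eqP-> /eqP->].
apply/idP/idP => [/eqP outE|lv].
  apply: contraT; rewrite negbK => stay.
  have stays b : in_block l i (out (inr (l, i, b))).
    have [->//|bm] := eqVneq b ord_max; have := out_incident (inr (l, i, b)).
    case: (out _) => [k|[[l' j] a]] /=; first by rewrite (negPf bm) !andbF.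
    by rewrite (negPf bm) andbF => /and3P[-> ->].
  (* An injection from the hyperedges of a block to its vertices is onto, so vertex [ord0] would be
     matched inside block [i] and also from block [i']. *)
  have /injF_bij[g _ gK] : injective (fun b => idx (out (inr (l, i, b)))).
    move=> b b' /= eqi; suff: inr (l, i, b) = inr (l, i, b') :> site by case.
    by apply: (can_inj outK); rewrite (blockE _ (stays b)) eqi -blockE.
  have := outE; rewrite -(gK ord0) -blockE // => /(can_inj outK)[ii].
  by have /eqP := Ei; rewrite ii; lia.
apply: contraT => nout.
have stays a : in_block l i (inv (inr (l, i, a))).
  have := out_incident (inv (inr (l, i, a))); rewrite invK.
  case E: (inv _) => [k|[[l' j] b]] /=.
    by case/and3P=> _ /eqP im; have := ltn_ord i'; rewrite Ei im /=; lia.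
  case/andP=> /eqP El; case: ifP => [/andP[/eqP a0 /eqP bm] /eqP ij|_].
    have ji' : j = i' by apply: val_inj; rewrite /= Ei ij.
    case/eqP: nout; apply: (can_inj invK).
    by rewrite outK -a0 E -El ji' bm.
  by case/andP=> /eqP-> _; rewrite El !eqxx.
have /injF_bij[g _ gK] : injective (fun a => idx (inv (inr (l, i, a)))).
  move=> b b' /= eqi; suff: inr (l, i, b) = inr (l, i, b') :> site by case.
  by apply: (can_inj invK); rewrite (blockE _ (stays b)) eqi -blockE.
move: lv; rewrite /leaves -(gK ord_max) -blockE // invK /=.
by rewrite !eqxx.
Qed.

Lemma leaves_const l i : leaves l i = leaves l ord0.
Proof.
case: i => i; elim: i => [|i IH] ltiL; first by congr leaves; apply: val_inj.
by rewrite -(IH (ltnW ltiL)); apply: leaves_step.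
Qed.

(** The source must be matched, and it meets only the [ord_max] hyperedges of the first blocks of
    its chains. *)
Lemma ex_leaves k : exists2 l, l.1 = k & leaves l ord0.
Proof.
have [inv outK invK] := out_bij.
have := out_incident (inv (inl k)); rewrite invK.
case E: (inv _) => [k'|[[l i] b]] //= /and3P[/eqP lk /eqP i0 /eqP bm].
by exists l => //; rewrite leaves0 -bm -i0 -E invK lk.
Qed.

Lemma leaves_uniq l l' : l.1 = l'.1 -> leaves l ord0 -> leaves l' ord0 -> l = l'.
Proof.
rewrite !leaves0 => -> /eqP <- /eqP /(bij_inj out_bij).
by case.
Qed.

End Matching.

(** * Locality under the exchange of two chains *)

Section Swap.

Variables p q : link.

Definition swap_site (x : site) : site :=
  if x is inr (l, i, a) then inr (tperm p q l, i, a) else x.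

Lemma swap_siteK : involutive swap_site.
Proof. by case=> [//|[[l i] a]] /=; rewrite tpermK. Qed.

Definition swap_node (x : bnode chain_hypergraph) : bnode chain_hypergraph :=
  match x with inl v => inl (swap_site v) | inr e => inr (swap_site e) end.

Lemma swap_nodeK : involutive swap_node.
Proof. by case=> x /=; rewrite swap_siteK. Qed.

(* No walk of length [t] from a deep site reaches a source or a sink. *)
Definition deep (t : nat) (x : site) : bool :=
  if x is inr (_, i, _) then t <= i <= L - t else false.

Definition deep_node (t : nat) (x : bnode chain_hypergraph) : bool :=
  match x with inl v => deep t v | inr e => deep t e end.

(** Between block sites only equality of chains matters, which a permutation preserves. The copy of
    a chain matters only next to a source or sink, where no deep site lies. *)
Lemma incident_swap v e : deep 1 v || deep 1 e ->
  incident (swap_site v) (swap_site e) = incident v e.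
Proof.
case: v => [k|[[l i] a]]; case: e => [k'|[[l' i'] b]] //=; rewrite ?orbF.
- move=> di; have -> : (i' == ord0) = false by rewrite -val_eqE /=; lia.
  by rewrite !andbF.
- move=> di; have -> : (i == ord_max) = false by rewrite -val_eqE /=; lia.
  by rewrite !andbF.
- by rewrite (inj_eq perm_inj).
Qed.

Lemma incident_deep t v e : incident v e ->
  (deep t.+1 v -> deep t e) /\ (deep t.+1 e -> deep t v).
Proof.
case: v => [k|[[l i] a]]; case: e => [k'|[[l' i'] b]] //=.
- by case/and3P=> _ /eqP-> _; split=> //=.
- by case/and3P=> _ /eqP-> _; split=> //=; lia.
- case/andP=> _; case: ifP => [_ /eqP|_ /andP[/eqP->]]; have := ltn_ord i';
    move=> *; split; lia.
Qed.

Lemma badj_swap x y : deep_node 1 x ->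
  badj (swap_node x) (swap_node y) = badj x y.
Proof.
case: x => x; case: y => y //= dx; rewrite !inE.
  by apply: incident_swap; rewrite dx.
by apply: incident_swap; rewrite dx orbT.
Qed.

Lemma badj_deep t x y : badj x y -> deep_node t.+1 x -> deep_node t y.
Proof.
by case: x => x; case: y => y //=; rewrite inE => /(incident_deep t)[].
Qed.

Lemma card_badj (x : bnode chain_hypergraph) : #|[set y | badj x y]| = delta.
Proof.
case: x => x.
  pose f (e : site) : bnode chain_hypergraph := inr e.
  have f_inj : injective f by move=> ? ? [].
  rewrite -[RHS](card_incident_edges x) -(card_imset _ f_inj).
  apply: eq_card => y; rewrite inE; apply/idP/imsetP => [|[e xe ->]].
    by case: y => //= e; rewrite inE => xe; exists e; rewrite ?inE.
  by move: xe; rewrite /= !inE.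
pose f (v : site) : bnode chain_hypergraph := inl v.
have f_inj : injective f by move=> ? ? [].
rewrite -[RHS](card_incident_vertices x) -(card_imset _ f_inj).
apply: eq_card => y; rewrite inE; apply/idP/imsetP => [|[e xe ->]].
  by case: y => //= e; rewrite inE => xe; exists e; rewrite ?inE.
by move: xe; rewrite /= !inE.
Qed.

Variables (A : local_algorithm) (id : bnode chain_hypergraph -> nat).
Hypothesis id_inj : injective id.

(** A state after [t] rounds depends only on the ball of radius [t]. Around a deep node the exchange
    preserves adjacency there, and it carries the IDs along. *)
Lemma state_at_swap t x : deep_node t x ->
  state_at A (id \o swap_node) t x = state_at A id t (swap_node x).
Proof.
elim: t x => [|t IH] x dx /=.
  (* All nodes have [delta] neighbours, so the inputs agree. *)
  by congr init; rewrite /input_at !card_badj; case: x dx.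
have dx1 : deep_node 1 x.
  by case: x dx => -[//|[[l i] a]] /=; lia.
have dxt : deep_node t x.
  by case: x dx {dx1} => -[//|[[l i] a]] /=; lia.
rewrite IH //; congr receive; apply: functional_extensionality => n.
(* By injectivity of the IDs, both inboxes select corresponding senders. *)
rewrite /inbox; case: pickP => [y /andP[xy /eqP yn]|none].
  case: pickP => [z /andP[xz /eqP zn]|/(_ (swap_node y))]; last first.
    by rewrite badj_swap // xy /= -yn /= eqxx.
  have -> : z = swap_node y by apply: id_inj; rewrite zn -yn.
  by rewrite IH // (badj_deep xy).
case: pickP => [z /andP[xz /eqP zn]|//].
have := none (swap_node z); rewrite -badj_swap // swap_nodeK xz /=.
by rewrite swap_nodeK zn eqxx.
Qed.

End Swap.

End Construction.

(** * Choice of IDs and chain length, and the contradiction *)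

Lemma valid_ids_enum_rank (c : nat) (G : hypergraph) :
  1 <= c -> valid_ids c (fun x : bnode G => (enum_rank x).+1).
Proof.
move=> c_gt0; split=> [x y [/val_inj/enum_rank_inj] //|x].
rewrite /= (leq_trans (ltn_ord (enum_rank x))) // -[X in X <= _]expn1.
by apply: leq_pexp2l => //; apply/card_gt0P; exists x.
Qed.

Lemma card_chain_vert delta L (delta_gt1 : 1 < delta) :
  #|vert (chain_hypergraph L delta_gt1)| = 2 + 2 * delta * L.+1 * delta.+1.
Proof. by rewrite card_sum !card_prod !card_ord !card_bool. Qed.

Lemma little_o_at_chain (T : nat -> nat) (delta : nat) :
  0 < delta -> is_little_o_n T ->
  exists2 m, 0 < m & T (2 + 2 * delta * m.*2.+1 * delta.+1) <= m.
Proof.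
move=> delta_gt0 To; pose K := delta * delta.+1.
have K_gt0 : 0 < K by rewrite muln_gt0 delta_gt0.
(* For [m = n0.+1] and [K >= 1], the vertex count [2 + 2K(2m + 1)] is at most [8Km], so this epsilon
   gives [T <= m]. *)
have [|n0 Hn0] := To ((8 * K)%:R^-1)%R.
  by rewrite Num.Theory.invr_gt0 Num.Theory.ltr0n; lia.
exists n0.+1 => //.
have -> : 2 + 2 * delta * n0.+1.*2.+1 * delta.+1 = 2 + 2 * K * n0.+1.*2.+1.
  by rewrite /K; lia.
move: K K_gt0 Hn0 => K K_gt0 Hn0.
have /Hn0 : n0 <= 2 + 2 * K * n0.+1.*2.+1 by nia.
rewrite GRing.mulrC Num.Theory.ler_pdivlMr ?Num.Theory.ltr0n; last by lia.
rewrite -GRing.natrM Num.Theory.ler_nat; nia.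
Qed.

Theorem theorem1p5 (delta : nat) (hdelta : 2 <= delta)
    (c : nat) (hc : 1 <= c) :
  ~ exists (A : local_algorithm) (T : nat -> nat),
      is_little_o_n T /\
      computes_HSO A T c
        (fun G => simple_hypergraph G /\ min_degree G delta /\ max_rank G delta).
Proof.
case=> A [T [To AT]]; have [m m_gt0 Tm] := little_o_at_chain (ltnW hdelta) To.
pose G := chain_hypergraph m.*2 hdelta.
have HSO (id : bnode G -> nat) : valid_ids c id -> is_HSO (outgoing_at A id (T #|vert G|)).
  move=> vid; suff CG : simple_hypergraph G /\
      min_degree G delta /\ max_rank G delta by case: (AT G id CG vid).
  split; first exact: chain_simple.
  by split; [exact: chain_min_degree | exact: chain_max_rank].
have Tn : T #|vert G| <= m by rewrite card_chain_vert.
set t := T _ in HSO Tn.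
pose id (x : bnode G) := (enum_rank x).+1.
have [id_inj id_bd] : valid_ids c id by exact: valid_ids_enum_rank.
have [out [out_bij out_inc outE]] :=
  is_HSO_matching (HSO _ (conj id_inj id_bd)) (erefl _).
have {}out_inc e : incident (out e) e by have := out_inc e; rewrite inE.
have [p pT lv_p] := ex_leaves out_bij out_inc true.
have [q0 q0F lv_q0] := ex_leaves out_bij out_inc false.
(* Copy [false] has at least two chains and only [q0] is matched. *)
have [q qF nlv_q] : exists2 q : link delta, q.1 = false & ~~ leaves out q ord0.
  have [j jq] : exists j, j != q0.2.
    have : 0 < #|[set~ q0.2]| by rewrite cardsC1 card_ord; lia.
    by case/card_gt0P=> j; rewrite !inE; exists j.
  exists (false, j) => //; apply: contra jq => lv.
  by rewrite -(leaves_uniq out_bij out_inc _ lv lv_q0).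
pose sw := @swap_node delta m.*2 hdelta p q.
have vid' : valid_ids c (id \o sw).
  split=> [|x]; last exact: id_bd.
  by apply: inj_comp id_inj _; apply/inv_inj/swap_nodeK.
have [out' [out'_bij out'_inc out'E]] := is_HSO_matching (HSO _ vid') (erefl _).
have {}out'_inc e : incident (out' e) e by have := out'_inc e; rewrite inE.
(* Block [m] of the [2m + 1] blocks is deep for every radius up to [m], hence for [t]. *)
have ltm : m < m.*2.+1 by lia.
pose mid := Ordinal ltm.
have lv_swap l : leaves out' l mid = leaves out (tperm p q l) mid.
  rewrite /leaves; set e : site delta m.*2 := inr (l, mid, ord_max).
  have deep_e s : s <= m -> deep s e by move=> sm /=; lia.
  (* Under the exchanged IDs, [e] outputs what its image outputs in the original run, and this ID
     now names the exchanged vertex. *)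
  have out_swap : out (swap_site p q e) = swap_site p q (out' e).
    apply/eqP; rewrite -outE ?inE ?incident_swap ?deep_e ?orbT //.
    have : outgoing_at A (id \o sw) t e (out' e) by rewrite out'E ?inE.
    by rewrite /outgoing_at /output_at state_at_swap //; exact: deep_e.
  have -> : inr (tperm p q l, mid, ord_max) = swap_site p q e by [].
  rewrite out_swap; case: (out' e) => [//|[[l' i'] a]] /=.
  by rewrite (inj_eq perm_inj).
have [l lT lv_l] := ex_leaves out'_bij out'_inc true.
have {lv_l} : leaves out (tperm p q l) ord0.
  by rewrite -(leaves_const hdelta out_bij out_inc _ mid) -lv_swap
     (leaves_const hdelta out'_bij out'_inc).
(* The chain [l] matched in copy [true] after the exchange cannot be [p], which now behaves like the
   unmatched [q], nor [q], which lies in the other copy, nor a third chain, as only [p] was matched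
   there. *)
case: tpermP => [_|lq|lp _ lv_l]; first by rewrite (negPf nlv_q).
  by rewrite lq qF in lT.
by case: lp; apply: (leaves_uniq out_bij out_inc _ lv_l lv_p); rewrite lT pT.
Qed.
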